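(* $\mathfrak{L}(\mathbf{F}_2\times\mathbf{F}_2)^w_{O(n)} \subsetneq \mathsf{RE}$.
   Context: For a group $G$ with identity $e$, a $G$-automaton is a tuple $(Q,\Sigma,G,\delta,q_0,Q_a)$ where $Q$ is a finite set of states, $\Sigma$ a finite input alphabet, $q_0\in Q$ the initial state, $Q_a\subseteq Q$ the accepting states, and $\delta$ assigns to each $(q,\sigma)\in Q\times(\Sigma\cup\{\varepsilon\})$ a finite set of pairs $(q',m)\in Q\times G$. The register holds an element of $G$, initially $e$; using a transition $(q',m)\in\delta(q,\sigma)$ (one step) the automaton reads $\sigma$ (or nothing), moves to $q'$ and replaces the register content $x$ by $xm$. A word is accepted if some computation reads it entirely and ends in an accepting state with register equal to $e$. A $G$-automaton recognizing $\mathtt{L}$ is weakly $t(n)$ time-bounded if every $x\in\mathtt{L}$ with $|x|=n$ has an accepting computation of at most $t(n)$ steps; $\mathfrak{L}(G)^w_{O(n)}$ is the class of languages recognized by weakly $t(n)$ time-bounded $G$-automata for some $t(n)=O(n)$. $\mathbf{F}_2$ is the free group of rank 2; $\mathsf{RE}$ is the class of recursively enumerable languages. *)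

(* Defs.v *)
From mathcomp Require Import all_boot.
From Stdlib Require List.
Set Implicit Arguments.
Unset Strict Implicit.
Unset Printing Implicit Defensive.

(* A letter is (generator, inverted?) : generator false = a, true = b. *)
Definition letter := (bool * bool)%type.
Definition linv (l : letter) : letter := (l.1, ~~ l.2).

Fixpoint freered (w : seq letter) : seq letter :=
  match w with
  | [::] => [::]
  | l :: w0 =>
      match freered w0 with
      | l' :: w' => if l' == linv l then w' else l :: l' :: w'
      | [::] => [:: l]
      end
  end.

Fixpoint reduced (w : seq letter) : bool :=
  match w with
  | l :: ((l' :: _) as w0) => (l' != linv l) && reduced w0
  | _ => true
  end.

Lemma reduced_behead (l : letter) w : reduced (l :: w) -> reduced w.
Proof. by case: w => //= l' w /andP[]. Qed.

Lemma freered_reduced w : reduced (freered w).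
Proof.
elim: w => //= l w IH.
case: (freered w) IH => [|l' w'] // IH.
case: ifP => H; first exact: reduced_behead IH.
by apply/andP; split; [rewrite H | exact: IH].
Qed.

Definition F2 := {w : seq letter | reduced w}.
Definition F2e : F2 := exist _ [::] isT.
Definition F2mul (u v : F2) : F2 :=
  exist _ (freered (val u ++ val v)) (freered_reduced _).

Definition F2xF2 := (F2 * F2)%type.
Definition F2xF2e : F2xF2 := (F2e, F2e).
Definition F2xF2mul (x y : F2xF2) : F2xF2 := (F2mul x.1 y.1, F2mul x.2 y.2).

Record Gautomaton (G : Type) (Sigma : finType) := GAut {
  gQ : finType;
  gdelta : gQ -> option Sigma -> seq (gQ * G);  (* finite set of pairs; None = epsilon *)
  gq0 : gQ;
  gacc : pred gQ
}.

Section Run.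
Variables (G : Type) (mul : G -> G -> G) (e : G) (Sigma : finType).
Variable A : Gautomaton G Sigma.

Inductive accepting_from : gQ A -> G -> seq Sigma -> nat -> Prop :=
| AccEnd q x : gacc q -> x = e -> accepting_from q x [::] 0
| AccEps q x w k q' m :
    List.In (q', m) (gdelta q None) ->
    accepting_from q' (mul x m) w k -> accepting_from q x w k.+1
| AccSym q x a w k q' m :
    List.In (q', m) (gdelta q (Some a)) ->
    accepting_from q' (mul x m) w k -> accepting_from q x (a :: w) k.+1.

Definition gaccepts (w : seq Sigma) : Prop :=
  exists k, accepting_from (gq0 A) e w k.

Definition grecognizes (L : seq Sigma -> Prop) : Prop :=
  forall w, L w <-> gaccepts w.

Definition weakly_time_bounded (t : nat -> nat) : Prop :=
  forall w, gaccepts w -> exists k, k <= t (size w) /\ accepting_from (gq0 A) e w k.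
End Run.

Definition is_O_n (t : nat -> nat) : Prop :=
  exists c n0, forall n, n0 <= n -> t n <= c * n.

Definition LGw_lin (G : Type) (mul : G -> G -> G) (e : G)
  (Sigma : finType) (L : seq Sigma -> Prop) : Prop :=
  exists (A : Gautomaton G Sigma) (t : nat -> nat),
    grecognizes mul e A L /\ is_O_n t /\ weakly_time_bounded mul e A t.

Record TM (Sigma : finType) := MkTM {
  tQ : finType;
  tGamma : finType;
  tblank : tGamma;
  tinp : Sigma -> tGamma;
  tinp_inj : injective tinp;
  tinp_blank : forall a, tinp a != tblank;
  tdelta : tQ -> tGamma -> option (tQ * tGamma * bool); (* bool: true = move right *)
  tq0 : tQ;
  tacc : pred tQ
}.

Section TMrun.
Variables (Sigma : finType) (M : TM Sigma).
(* configuration: state, left part of tape (reversed, nearest first),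
   right part starting with the scanned cell (missing cells are blank) *)
Definition tconf := (tQ M * seq (tGamma M) * seq (tGamma M))%type.

Definition tstep (c : tconf) : option tconf :=
  let: (q, l, r) := c in
  match tdelta q (head (tblank M) r) with
  | None => None
  | Some (q', b, true) => Some (q', b :: l, behead r)
  | Some (q', b, false) =>
      match l with
      | c0 :: l' => Some (q', l', c0 :: b :: behead r)
      | [::] => Some (q', [::], b :: behead r)
      end
  end.

Fixpoint trun (n : nat) (c : tconf) : option tconf :=
  match n with
  | 0 => Some c
  | n'.+1 => match tstep c with Some c' => trun n' c' | None => None end
  end.

Definition taccepts (w : seq Sigma) : Prop :=
  exists n q l r, trun n (@tq0 _ M, [::], map (@tinp _ M) w) = Some (q, l, r) /\ @tacc _ M q.
End TMrun.

Definition RE (Sigma : finType) (L : seq Sigma -> Prop) : Prop :=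
  exists M : TM Sigma, forall w, L w <-> taccepts M w.

(* Main.v *)
(* A weakly linear-time recognised language is decidable: on an input of length
   n it suffices to inspect the runs of at most c * n + d steps. Lists of natural
   numbers are coded as natural numbers, and one primitive recursive function
   [ucheck e l b x] decides whether the automaton with transition table coded by
   [e] has an accepting run, of length bounded by [l], on the word coded by [x].
   Primitive recursive predicates are recognised by Turing machines, through
   while programs and counter machines, which gives the inclusion.
   For strictness, the unary language of the words of length n that [ucheck],
   run with the table coded in n and the bound n ^ 2 + 2, rejects is decidable.
   It differs from the language of every linearly bounded automaton at the
   lengths n that code its table and exceed its time constants. *)
Require Import Defs.
From mathcomp Require Import all_boot zify.
Set Implicit Arguments.
Unset Strict Implicit.
Unset Printing Implicit Defensive.

(** * Turing machines on functional tapes *)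

Section Tape.
Variables (Sigma : finType) (M : TM Sigma).
Implicit Types (c : tconf M) (q : tQ M) (h : nat) (T : nat -> tGamma M).

(** Lists that differ by trailing blanks describe the same tape; reading them with the blank as
    default value removes the difference. *)
Definition holds c q h T :=
  [/\ c.1.1 = q, size c.1.2 = h
    & forall j, nth (tblank M) (rev c.1.2 ++ c.2) j = T j].

Definition write T h b : nat -> tGamma M := fun j => if j == h then b else T j.

(** A left move on cell 0 leaves the head there, in agreement with the truncated predecessor. *)
Lemma tstep_holds c q h T q' b d :
    holds c q h T -> tdelta q (T h) = Some (q', b, d) ->
  exists2 c', tstep c = Some c' &
    holds c' q' (if d then h.+1 else h.-1) (write T h b).
Proof.
case: c => [[q0 l] r] [/= -> <- ET] Eq.
have Er : head (tblank M) r = T (size l).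
  by rewrite -ET nth_cat size_rev ltnn subnn; case: (r).
have ET' j : T j = nth (tblank M) (rev l ++ head (tblank M) r :: behead r) j.
  rewrite -ET; case: (r) => //=.
  by rewrite !nth_cat nth_nil; case: ifP => // _; case: (_ - _) => // n; rewrite /= nth_nil.
have W j : nth (tblank M) (rev l ++ b :: behead r) j = write T (size l) b j.
  rewrite /write ET' !nth_cat size_rev; case: ltngtP => // [lj|->]; last by rewrite subnn.
  by rewrite -(subnKC lj) addSn -addnS addKn.
rewrite Er Eq; case: d Eq => _.
  exists (q', b :: l, behead r) => //; split=> //= j.
  by rewrite rev_cons cat_rcons.
case: l {ET Er} ET' W => [|a l] ET' W.
  by exists (q', [::], b :: behead r).
exists (q', l, a :: b :: behead r) => //; split=> //= j.
by rewrite -W rev_cons cat_rcons.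
Qed.

Lemma trunD m n c :
  trun (m + n) c = if trun m c is Some c' then trun n c' else None.
Proof. by elim: m c => //= m IH c; case: (tstep c). Qed.

Definition leads q h T q' h' T' := forall c, holds c q h T ->
  exists n c', trun n c = Some c' /\ holds c' q' h' T'.

Lemma leads_eq q h T T' : T =1 T' -> leads q h T q h T'.
Proof.
by move=> E c [H1 H2 H3]; exists 0, c; split=> //; split=> // j; rewrite H3.
Qed.

Lemma leads_trans q1 h1 T1 q2 h2 T2 q3 h3 T3 :
  leads q1 h1 T1 q2 h2 T2 -> leads q2 h2 T2 q3 h3 T3 -> leads q1 h1 T1 q3 h3 T3.
Proof.
move=> H1 H2 c /H1 [m [c' [E /H2 [n [c'' [E' H]]]]]].
by exists (m + n), c''; rewrite trunD E.
Qed.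

Lemma leads_step q h T q' b d : tdelta q (T h) = Some (q', b, d) ->
  leads q h T q' (if d then h.+1 else h.-1) (write T h b).
Proof.
by move=> Ed c /tstep_holds /(_ Ed) [c' E H]; exists 1, c'; rewrite /= E.
Qed.

Lemma write_id T h : write T h (T h) =1 T.
Proof. by move=> j; rewrite /write; case: eqP => // ->. Qed.

Lemma leads_move q h T q' d : tdelta q (T h) = Some (q', T h, d) ->
  leads q h T q' (if d then h.+1 else h.-1) T.
Proof.
by move=> Ed; apply: leads_trans (leads_step Ed) (leads_eq (write_id _ _)).
Qed.

Lemma leads_scan q h T :
    (forall j, j < h -> tdelta q (T j) = Some (q, T j, true)) ->
  leads q 0 T q h T.
Proof.
elim: h => [|h IH] H; first exact: leads_eq.
apply: leads_trans (leads_move (H h (ltnSn h))).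
by apply: IH => j jh; apply: H; apply: leqW.
Qed.

(** The machine is deterministic, and accepting configurations as well as the one reached are stuck,
    so an accepting configuration of the run can only be the one reached. *)
Lemma taccepts_leads w q h T :
    (forall q' g, tacc q' -> tdelta q' g = None) ->
    leads (tq0 M) 0 (nth (tblank M) (map (@tinp _ M) w)) q h T ->
    tdelta q (T h) = None ->
  taccepts M w <-> tacc q.
Proof.
move=> accN /(_ (tq0 M, [::], map (@tinp _ M) w)) [//|n [c [Ec [Eq Eh ET]]]] qN.
have stuck c' : tdelta c'.1.1 (head (tblank M) c'.2) = None -> tstep c' = None.
  by case: c' => [[? ?] ?] /= ->.
have accS c' : tacc c'.1.1 -> tstep c' = None by move=> /accN E; apply: stuck.
have cS : tstep c = None.
  apply: stuck; rewrite Eq -[RHS]qN -ET nth_cat size_rev Eh ltnn subnn.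
  by case: (c.2).
split=> [[m [q1 [l1 [r1 [Em aq]]]]]|aq]; last first.
  by exists n, q, c.1.2, c.2; rewrite Ec -Eq; split; [case: (c) => [[]]|rewrite Eq].
have S c1 k : tstep c1 = None -> trun k c1 = Some c -> c1 = c.
  by case: k => [|k] E /=; [move=> [->]|rewrite E].
have S' c1 k : trun k c = Some c1 -> c1 = c.
  by case: k => [|k] /=; [move=> [->]|rewrite cS].
have [mn|/ltnW nm] := leqP m n.
  move: Ec; rewrite -(subnKC mn) trunD Em => /S E.
  by rewrite -Eq -E //; apply: (accS (_, _, _)).
by move: Em; rewrite -(subnKC nm) trunD Ec => /S' E; rewrite -Eq -E.
Qed.

End Tape.

(** * Counter machines *)

Inductive instr (Sigma : finType) :=
  | INC (r : nat)
  | DEC (r l : nat)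
  | JMP (l : nat)
  | READ (f : option Sigma -> nat)
  | HALT (b : bool).
Arguments INC {Sigma}.
Arguments DEC {Sigma}.
Arguments JMP {Sigma}.
Arguments HALT {Sigma}.

Definition upd (s : nat -> nat) r n : nat -> nat := fun x => if x == r then n else s x.

Section CounterMachine.
Variables (Sigma : finType) (P : seq (instr Sigma)).

(** The default value makes a program counter past the end halt and reject. *)
Definition at_pc pc := nth (HALT false) P pc.

Inductive goes : nat -> (nat -> nat) -> seq Sigma -> nat -> (nat -> nat) -> seq Sigma -> Prop :=
  | GoRefl pc s i : goes pc s i pc s i
  | GoInc pc s i r pc' s' i' : at_pc pc = INC r ->
      goes pc.+1 (upd s r (s r).+1) i pc' s' i' -> goes pc s i pc' s' i'
  | GoDec0 pc s i r l pc' s' i' : at_pc pc = DEC r l -> s r = 0 ->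
      goes l s i pc' s' i' -> goes pc s i pc' s' i'
  | GoDecS pc s i r l n pc' s' i' : at_pc pc = DEC r l -> s r = n.+1 ->
      goes pc.+1 (upd s r n) i pc' s' i' -> goes pc s i pc' s' i'
  | GoJmp pc s i l pc' s' i' : at_pc pc = JMP l ->
      goes l s i pc' s' i' -> goes pc s i pc' s' i'
  | GoRead pc s i f pc' s' i' : at_pc pc = READ f ->
      goes (f (ohead i)) s (behead i) pc' s' i' -> goes pc s i pc' s' i'.

Lemma goes_trans pc1 s1 i1 pc2 s2 i2 pc3 s3 i3 :
  goes pc1 s1 i1 pc2 s2 i2 -> goes pc2 s2 i2 pc3 s3 i3 -> goes pc1 s1 i1 pc3 s3 i3.
Proof.
elim=> // *; [apply: GoInc|apply: GoDec0|apply: GoDecS|apply: GoJmp|apply: GoRead]; eauto.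
Qed.

(** * Simulation of a counter machine by a Turing machine *)

Definition ireg (x : instr Sigma) :=
  match x with INC r => r | DEC r _ => r | _ => 0 end.
Definition nreg := \max_(x <- P) ireg x.

Lemma ireg_at pc : ireg (at_pc pc) <= nreg.
Proof.
rewrite /at_pc /nreg; elim: P pc => [|x p IH] pc; first by rewrite nth_nil.
rewrite big_cons; case: pc => [|pc] /=; first exact: leq_maxl.
exact: leq_trans (IH pc) (leq_maxr _ _).
Qed.

(* A cell records whether it is the leftmost one, the input letter it carries
   ([Some None] once the letter has been read, [None] past the input), and, for
   each register, whether its index is below the content of the register. *)
Definition cell := (bool * option (option Sigma) * {set 'I_nreg.+1})%type.

Definition cblank : cell := (false, None, set0).
Definition cinp (a : Sigma) : cell := (false, Some (Some a), set0).

Lemma cinp_inj : injective cinp. Proof. by move=> a b []. Qed.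
Lemma cinp_blank a : cinp a != cblank. Proof. by []. Qed.

Definition setbit (g : cell) r : cell := (g.1, inord r |: g.2).
Definition clrbit (g : cell) r : cell := (g.1, g.2 :\ inord r).
Definition bit (g : cell) r := inord r \in g.2.

(* [None] is the start; the mode of [Some (pc, mode)] is [None] when the
   instruction at [pc] is being executed moving right, [Some true] when the last
   mark of a register is about to be erased, and [Some false] when the head
   returns to the left end. *)
Definition cstate := option ('I_(size P).+1 * option bool).

(** All positions past the end are merged into [size P], where the default instruction applies; this
    keeps the state set finite. *)
Definition go (pc : nat) (m : option bool) : cstate := Some (inord (minn pc (size P)), m).

(** Registers are kept in unary. The start step marks cell 0, so that a head returning to the left
    can recognise it. *)
Definition cdelta (q : cstate) (g : cell) : option (cstate * cell * bool) :=
  match q with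
  | None => Some (go 0 None, (true, g.1.2, g.2), false)
  | Some (p, Some false) =>
      Some (Some (p, if g.1.1 then None else Some false), g, false)
  | Some (p, Some true) =>
      if at_pc p is DEC r l then
        if bit g r then Some (go p.+1 (Some false), clrbit g r, false)
        else Some (go l (Some false), g, false)
      else None
  | Some (p, None) =>
      match at_pc p with
      | INC r => if bit g r then Some (q, g, true)
                 else Some (go p.+1 (Some false), setbit g r, false)
      | DEC r l => if bit g r then Some (q, g, true)
                   else Some (Some (p, Some true), g, false)
      | JMP l => Some (go l None, g, false)
      | READ f =>
          match g.1.2 with
          | Some None => Some (q, g, true)
          | Some (Some a) => Some (go (f (Some a)) (Some false), (g.1.1, Some None, g.2), false)
          | None => Some (go (f None) (Some false), g, false)
          end
      | HALT _ => None
      end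
  end.

Definition cacc (q : cstate) :=
  if q is Some (p, None) then if at_pc p is HALT true then true else false else false.

Definition cTM : TM Sigma := MkTM cinp_inj cinp_blank cdelta None cacc.

Definition ctape (s : nat -> nat) (u : nat) (i : seq Sigma) (j : nat) : cell :=
  (j == 0, nth None (nseq u (Some None) ++ [seq Some (Some a) | a <- i]) j,
   [set r : 'I_nreg.+1 | j < s r]).

Lemma at_go pc : at_pc (inord (minn pc (size P)) : 'I_(size P).+1) = at_pc pc.
Proof.
rewrite inordK ?ltnS ?geq_minr // /minn; case: ltnP => // le.
by rewrite /at_pc !nth_default.
Qed.

Lemma goS pc m : at_pc pc <> HALT false ->
  go (inord (minn pc (size P)) : 'I_(size P).+1).+1 m = go pc.+1 m.
Proof.
move=> H; have lt : pc < size P.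
  by rewrite ltnNge; apply/negP => le; apply: H; rewrite /at_pc nth_default.
by rewrite /go inordK ?ltnS ?geq_minr // (minn_idPl (ltnW lt)).
Qed.

Lemma bit_ctape s u i j r : r <= nreg -> bit (ctape s u i j) r = (j < s r).
Proof. by move=> le; rewrite /bit inE inordK. Qed.

Lemma eq_inord (x : 'I_nreg.+1) r : r <= nreg -> (x == inord r) = (x == r :> nat).
Proof. by move=> le; rewrite -val_eqE /= inordK. Qed.

Lemma return_home pc h T : (forall j, (T j).1.1 = (j == 0)) ->
  leads (M := cTM) (go pc (Some false)) h T (go pc None) 0 T.
Proof.
move=> HT; elim: h => [|h IH].
  by apply: (leads_move (q := go pc (Some false) : tQ cTM) (h := 0) (d := false)); rewrite /= HT.
apply: leads_trans IH.
by apply: (leads_move (q := go pc (Some false) : tQ cTM) (h := h.+1) (d := false)); rewrite /= HT.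
Qed.

Lemma step_home q pc h T b T' :
    tdelta (t := cTM) q (T h) = Some (go pc (Some false), b, false) ->
    write T h b =1 T' -> (forall j, (T' j).1.1 = (j == 0)) ->
  leads (M := cTM) q h T (go pc None) 0 T'.
Proof.
move=> Ed ET HT; apply: leads_trans (leads_step Ed) _.
exact: leads_trans (leads_eq ET) (return_home HT).
Qed.

Lemma leads_inc pc s u i r : at_pc pc = INC r ->
  leads (M := cTM) (go pc None) 0 (ctape s u i) (go pc.+1 None) 0 (ctape (upd s r (s r).+1) u i).
Proof.
move=> E; have le : r <= nreg by have := ireg_at pc; rewrite E.
apply: (@leads_trans _ cTM _ _ _ (go pc None) (s r) (ctape s u i)).
  by apply: leads_scan => j lt; rewrite /= at_go E bit_ctape // lt.
apply: step_home => //.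
  by rewrite /= at_go E bit_ctape // ltnn goS // E.
move=> j; rewrite /write; case: eqP => [->|Nj]; congr (_, _, _); apply/setP=> x;
  rewrite !inE /upd ?eq_inord //; case: eqP => [->|_] //=; lia.
Qed.

Lemma leads_dec pc s u i r l : at_pc pc = DEC r l ->
  leads (M := cTM) (go pc None) 0 (ctape s u i)
    (go (if s r is n.+1 then pc.+1 else l) None) 0 (ctape (upd s r (s r).-1) u i).
Proof.
move=> E; have le : r <= nreg by have := ireg_at pc; rewrite E.
apply: (@leads_trans _ cTM _ _ _ (go pc None) (s r) (ctape s u i)).
  by apply: leads_scan => j lt; rewrite /= at_go E bit_ctape // lt.
(* The head steps back from the first unmarked cell onto the last mark. If the register is zero, the
   head stays on cell 0 and finds no mark, which is the zero test. *)
apply: (@leads_trans _ cTM _ _ _ (go pc (Some true)) (s r).-1 (ctape s u i)).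
  by apply: (leads_move (q := go pc None : tQ cTM) (h := s r) (d := false));
    rewrite /= at_go E bit_ctape // ltnn.
case Er : (s r) => [|n] /=; apply: step_home => //.
- by rewrite /= at_go E bit_ctape // Er /=.
- move=> j; rewrite write_id; congr (_, _, _); apply/setP=> x.
  by rewrite !inE /upd; case: eqP => // ->; rewrite Er.
- by rewrite /= at_go E bit_ctape // Er ltnSn goS // E.
move=> j; rewrite /write; case: eqP => [->|Nj]; congr (_, _, _); apply/setP=> x;
  rewrite !inE /upd ?eq_inord //; case: eqP => [->|_] //=; lia.
Qed.

Lemma leads_read pc s u i f : at_pc pc = READ f ->
  exists u', leads (M := cTM) (go pc None) 0 (ctape s u i)
    (go (f (ohead i)) None) 0 (ctape s u' (behead i)).
Proof.
move=> E; have S : leads (M := cTM) (go pc None) 0 (ctape s u i) (go pc None) u (ctape s u i).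
  by apply: leads_scan => j lt; rewrite /= at_go E nth_cat size_nseq lt nth_nseq lt.
case: i S => [|a i] S; [exists u|exists u.+1]; apply: leads_trans S _; apply: step_home => //.
- by rewrite /= at_go E cats0 nth_nseq ltnn.
- exact: write_id.
- by rewrite /= at_go E nth_cat size_nseq ltnn subnn.
move=> j; rewrite /write /ctape /=.
have -> : nth None (nseq u.+1 (Some None) ++ [seq Some (Some a) | a <- i]) j =
    if j <= u then Some None else nth None [seq Some (Some a) | a <- i] (j - u.+1).
  by rewrite nth_cat size_nseq ltnS nth_nseq ltnS; case: leqP.
case: eqP => [->|/eqP Nj]; first by rewrite leqnn.
rewrite nth_cat size_nseq nth_nseq; case: ltngtP Nj => // lt _.
by have -> : j - u = (j - u.+1).+1 by lia.
Qed.

Lemma goes_leads pc s i pc' s' i' u : goes pc s i pc' s' i' ->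
  exists u', leads (M := cTM) (go pc None) 0 (ctape s u i) (go pc' None) 0 (ctape s' u' i').
Proof.
move=> H; elim: H u => {pc s i pc' s' i'} [pc s i|pc s i r|pc s i r l|pc s i r l n|pc s i l|pc s i f].
- by move=> u; exists u; apply: leads_eq.
- move=> pc' s' i' E _ IH u; have [u' H] := IH u.
  by exists u'; apply: leads_trans H; apply: leads_inc.
- move=> pc' s' i' E E0 _ IH u; have [u' H] := IH u.
  exists u'; apply: leads_trans H; have := leads_dec (s := s) (u := u) (i := i) E.
  rewrite E0 => H; apply: leads_trans H _; apply: leads_eq => j.
  by congr (_, _, _); apply/setP => x; rewrite !inE /upd; case: eqP => // ->; rewrite E0.
- move=> pc' s' i' E E0 _ IH u; have [u' H] := IH u.
  exists u'; apply: leads_trans H; have := leads_dec (s := s) (u := u) (i := i) E.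
  by rewrite E0.
- move=> pc' s' i' E _ IH u; have [u' H] := IH u.
  exists u'; apply: leads_trans H.
  by apply: (leads_move (q := go pc None : tQ cTM) (h := 0) (d := false)); rewrite /= at_go E.
- move=> pc' s' i' E _ IH u; have [u1 H1] := leads_read s u i E; have [u' H] := IH u1.
  by exists u'; apply: leads_trans H.
Qed.

Lemma cTM_accepts w pc s i b : goes 0 (fun=> 0) w pc s i -> at_pc pc = HALT b ->
  taccepts cTM w <-> b.
Proof.
move=> /(goes_leads 0) [u H] E.
have -> : b = cacc (go pc None) by rewrite /= at_go E; case: (b).
apply: (@taccepts_leads _ cTM w (go pc None : tQ cTM) 0 (ctape s u i)).
- by move=> [[p [[]|]]|] g //=; case: (at_pc p).
- apply: leads_trans H.
  have Ed : tdelta (t := cTM) None (nth cblank (map cinp w) 0) =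
      Some (go 0 None, ctape (fun=> 0) 0 w 0, false).
    by congr (Some (_, _, _)); case: w => [|a w] /=; congr (_, _, _); apply/setP => x; rewrite !inE.
  apply: leads_trans (leads_step Ed) (leads_eq _) => j.
  rewrite /write; case: eqP => [->//|/eqP/negbTE Nj].
  rewrite /ctape Nj /=; have [lt|le] := ltnP j (size w).
    case: w lt {Ed} => // a w lt; rewrite !(nth_map a) //.
  by rewrite !nth_default ?size_map.
by rewrite /= at_go E.
Qed.

End CounterMachine.

(** * While programs *)

Section While.
Variable Sigma : finType.

Inductive cmd :=
  | Skip
  | Inc (r : nat)
  | Seq (c1 c2 : cmd)
  | While (r : nat) (c : cmd)
  | Read (r : nat).

(** Letters count from 1, since 0 signals the end of the input. *)
Definition rnext (i : seq Sigma) := if i is a :: _ then (enum_rank a).+1 else 0.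

Definition incr r (s : nat -> nat) := upd s r (s r).+1.

(* The loop [While r c] decrements [r] itself before each execution of [c]. *)
Inductive exec : cmd -> (nat -> nat) -> seq Sigma -> (nat -> nat) -> seq Sigma -> Prop :=
  | ExSkip s i : exec Skip s i s i
  | ExInc r s i : exec (Inc r) s i (incr r s) i
  | ExSeq c1 c2 s i s1 i1 s2 i2 :
      exec c1 s i s1 i1 -> exec c2 s1 i1 s2 i2 -> exec (Seq c1 c2) s i s2 i2
  | ExWhile0 r c s i : s r = 0 -> exec (While r c) s i s i
  | ExWhileS r c s i n s1 i1 s2 i2 : s r = n.+1 -> exec c (upd s r n) i s1 i1 ->
      exec (While r c) s1 i1 s2 i2 -> exec (While r c) s i s2 i2
  | ExRead r s i : exec (Read r) s i (iter (rnext i) (incr r) s) (behead i).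

(* The jump enters a block of [#|Sigma|] increments so that exactly the required
   number of them remains. *)
Definition read_target p (o : option Sigma) :=
  p.+1 + (#|Sigma| - if o is Some a then (enum_rank a).+1 else 0).

Fixpoint compile (c : cmd) (p : nat) : seq (instr Sigma) :=
  match c with
  | Skip => [::]
  | Inc r => [:: INC r]
  | Seq c1 c2 => let b := compile c1 p in b ++ compile c2 (p + size b)
  | While r c => let b := compile c p.+1 in
      DEC r (p + (size b).+2) :: b ++ [:: JMP p]
  | Read r => READ (read_target p) :: nseq #|Sigma| (INC r)
  end.

Lemma goes_incs (P : seq (instr Sigma)) r n p s i :
    (forall k, k < n -> at_pc P (p + k) = INC r) ->
  goes P p s i (p + n) (iter n (incr r) s) i.
Proof.
elim: n p s => [|n IH] p s H; first by rewrite addn0; constructor.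
rewrite iterSr addnS -addSn; apply: (GoInc (r := r)).
  by rewrite -(H 0) ?addn0.
by apply: IH => k lt; rewrite addSnnS; apply: H.
Qed.

Lemma at_pc_cat (p1 p2 : seq (instr Sigma)) x : at_pc (p1 ++ x :: p2) (size p1) = x.
Proof. by rewrite /at_pc nth_cat ltnn subnn. Qed.

(** Jump targets are absolute addresses, so the code is placed between arbitrary [pre] and [post];
    the induction applies this to subprograms with enlarged surroundings. *)
Lemma exec_goes c s i s' i' (pre post : seq (instr Sigma)) : exec c s i s' i' ->
  goes (pre ++ compile c (size pre) ++ post) (size pre) s i
       (size pre + size (compile c (size pre))) s' i'.
Proof.
move=> H; elim: H pre post => {c s i s' i'}.
- by move=> s i pre post; rewrite addn0; constructor.
- move=> r s i pre post; rewrite addn1.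
  by apply: (GoInc (r := r)); [exact: at_pc_cat|constructor].
- move=> c1 c2 s i s1 i1 s2 i2 _ IH1 _ IH2 pre post /=.
  apply: goes_trans; first by rewrite -catA; apply: IH1.
  have := IH2 (pre ++ compile c1 (size pre)) post.
  by rewrite !size_cat !catA addnA.
- move=> r c s i E0 pre post /=; rewrite size_cat /= addn1.
  by apply: (GoDec0 (r := r) (l := size pre + (size (compile c (size pre).+1)).+2));
    [exact: at_pc_cat|by []|constructor].
- move=> r c s i n s1 i1 s2 i2 Es _ IH1 _ IH2 pre post.
  apply: goes_trans (IH2 pre post).
  move=> /= {IH2}.
  set b := compile c _; set D := DEC _ _.
  have EP : pre ++ (D :: b ++ [:: JMP (size pre)]) ++ post =
            rcons pre D ++ b ++ JMP (size pre) :: post.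
    by rewrite cat_rcons /= -catA.
  apply: (GoDecS (r := r) (n := n)) => //; first exact: at_pc_cat.
  have := IH1 (rcons pre D) (JMP (size pre) :: post).
  rewrite size_rcons -EP -/b => H; apply: goes_trans H _.
  apply: (GoJmp (l := size pre)); last by constructor.
  by rewrite EP catA -(size_rcons pre D) -size_cat at_pc_cat.
move=> r s i pre post /=; rewrite size_nseq addnS -addSn.
apply: (GoRead (f := read_target (size pre))); first exact: at_pc_cat.
have le : rnext i <= #|Sigma| by case: i => //= a i; apply: ltn_ord.
have -> : (size pre).+1 + #|Sigma| = read_target (size pre) (ohead i) + rnext i.
  by rewrite /read_target -addnA; congr (_ + _); case: i le => [|a i] /=; lia.
apply: goes_incs => k lt.
rewrite /read_target -cat_rcons /at_pc nth_cat size_rcons.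
have -> : ((size pre).+1 + (#|Sigma| - (if ohead i is Some a then (enum_rank a).+1 else 0)) + k
     < (size pre).+1) = false by lia.
rewrite nth_cat size_nseq nth_nseq.
have -> // : (size pre).+1 + (#|Sigma| - (if ohead i is Some a then (enum_rank a).+1 else 0)) + k
     - (size pre).+1 < #|Sigma| by case: i le lt => [|a i] /=; lia.
Qed.

(** * Register programs for clearing, moving and copying *)

Definition Clear r := While r Skip.
Definition Move src dst := Seq (Clear dst) (While src (Inc dst)).
Definition Copy src dst tmp :=
  Seq (Clear dst) (Seq (Clear tmp)
    (Seq (While src (Seq (Inc dst) (Inc tmp))) (While tmp (Inc src)))).

Definition pure c s s' := forall i, exec c s i s' i.

Lemma pure_seq c1 c2 s1 s2 s3 : pure c1 s1 s2 -> pure c2 s2 s3 -> pure (Seq c1 c2) s1 s3.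
Proof. by move=> H1 H2 i; apply: ExSeq (H1 i) (H2 i). Qed.

(** The invariant is indexed by the number of iterations left; the body has to leave the loop
    register as it found it. *)
Lemma pure_while r c (I : nat -> (nat -> nat) -> Prop) s :
    (forall n s1, s1 r = n.+1 -> I n.+1 s1 ->
      exists s2, [/\ pure c (upd s1 r n) s2, s2 r = n & I n s2]) ->
    I (s r) s ->
  exists s', [/\ pure (While r c) s s', s' r = 0 & I 0 s'].
Proof.
move=> H; move En: (s r) => n; elim: n s En => [|n IH] s En Is.
  by exists s; split=> // i; constructor.
have [s1 [H1 E1 I1]] := H _ _ En Is; have [s2 [H2 E2 I2]] := IH _ E1 I1.
by exists s2; split=> // i; apply: ExWhileS En (H1 i) (H2 i).
Qed.

Lemma pure_clear r s :
  exists s', [/\ pure (Clear r) s s', s' r = 0 & forall x, x != r -> s' x = s x].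
Proof.
apply: (pure_while (I := fun _ s' => forall x, x != r -> s' x = s x)) => // n s1 E1 I1.
exists (upd s1 r n); split; [by move=> i; constructor|by rewrite /upd eqxx|].
by move=> x Nx; rewrite /upd (negbTE Nx) I1.
Qed.

Lemma pure_transfer src dst s : src != dst ->
  exists s', [/\ pure (While src (Inc dst)) s s', s' src = 0, s' dst = s dst + s src
    & forall x, x != src -> x != dst -> s' x = s x].
Proof.
move=> N.
have := @pure_while src (Inc dst) (fun n s' => s' dst + n = s dst + s src /\
  forall x, x != src -> x != dst -> s' x = s x) s.
case=> [n s1 E1 [I1 I2]|//|s' [H E [I1 I2]]]; last by exists s'; split; rewrite // -I1 addn0.
exists (incr dst (upd s1 src n)); split; first by move=> i; constructor.
  by rewrite /incr /upd (negbTE N) eqxx.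
split=> [|x Nx Ny]; rewrite /incr /upd.
  by rewrite eqxx eq_sym (negbTE N) -I1; lia.
by rewrite (negbTE Nx) (negbTE Ny) I2.
Qed.

Lemma pure_move src dst s : src != dst ->
  exists s', [/\ pure (Move src dst) s s', s' src = 0, s' dst = s src
    & forall x, x != src -> x != dst -> s' x = s x].
Proof.
move=> N; have [s1 [H1 E1 K1]] := pure_clear dst s.
have [s2 [H2 E2 E3 K2]] := pure_transfer s1 N.
exists s2; split; [exact: pure_seq H1 H2|by []|by rewrite E3 E1 K1|].
by move=> x N1 N2; rewrite K2 // K1.
Qed.

Lemma pure_copy src dst tmp s : src != dst -> src != tmp -> dst != tmp ->
  exists s', [/\ pure (Copy src dst tmp) s s', s' dst = s src
    & forall x, x != dst -> x != tmp -> s' x = s x].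
Proof.
move=> Nsd Nst Ndt; have [s1 [H1 E1 K1]] := pure_clear dst s.
have [s2 [H2 E2 K2]] := pure_clear tmp s1.
have := @pure_while src (Seq (Inc dst) (Inc tmp)) (fun n s' => [/\ s' dst + n = s src,
  s' tmp = s' dst & forall x, x != src -> x != dst -> x != tmp -> s' x = s x]) s2.
have Es : s2 src = s src by rewrite K2 // K1.
case=> [n s3 E3 [I1 I2 I3]||s3 [H3 E3 [I1 I2 I3]]].
- exists (incr tmp (incr dst (upd s3 src n))); split.
  + by move=> i; apply: ExSeq; constructor.
  + by rewrite /incr /upd (negbTE Nsd) (negbTE Nst) eqxx.
  split=> [||x N1 N2 N3]; rewrite /incr /upd.
  + by rewrite (negbTE Ndt) eqxx eq_sym (negbTE Nsd); lia.
  + rewrite (negbTE Ndt) !eqxx ![_ == src]eq_sym [_ == dst]eq_sym.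
    by rewrite (negbTE Nsd) (negbTE Nst) (negbTE Ndt) I2.
  + by rewrite (negbTE N1) (negbTE N2) (negbTE N3) I3.
- rewrite Es K2 // E1 E2; split=> // x N1 N2 N3; by rewrite K2 // K1.
have Nts : tmp != src by rewrite eq_sym.
have [s4 [H4 E4 E5 K4]] := pure_transfer s3 Nts.
exists s4; split.
- exact: pure_seq H1 (pure_seq H2 (pure_seq H3 H4)).
- by rewrite K4 // 1?eq_sym // -I1 addn0.
move=> x N1 N2; have [->|N3] := eqVneq x src; last by rewrite K4 // I3.
by rewrite E5 E3 I2 add0n -I1 addn0.
Qed.

End While.

(** * Primitive recursive functions *)

Definition scons (x : nat) (v : nat -> nat) : nat -> nat :=
  fun k => if k is j.+1 then v j else x.

Fixpoint prec (n a : nat) (f : nat -> nat -> nat) : nat :=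
  if n is k.+1 then f k (prec k a f) else a.

(* The arguments form an infinite list, so that no arity has to be tracked;
   [PR_let] pushes a value in front of it. *)
Inductive PR : ((nat -> nat) -> nat) -> Prop :=
  | PR_var k : PR (fun v => v k)
  | PR_zero : PR (fun=> 0)
  | PR_succ f : PR f -> PR (fun v => (f v).+1)
  | PR_let f g : PR f -> PR g -> PR (fun v => f (scons (g v) v))
  | PR_ren (r : nat -> nat) f : PR f -> PR (fun v => f (fun k => v (r k)))
  | PR_prec0 n a f : PR n -> PR a -> PR f ->
      PR (fun v => prec (n v) (a v) (fun k x => f (scons x (scons k v))))
  | PR_ext f g : f =1 g -> PR f -> PR g.

Lemma eq_prec n a f g : f =2 g -> prec n a f = prec n a g.
Proof. by move=> E; elim: n => //= n ->; apply: E. Qed.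

Lemma eq_scons x v w : v =1 w -> scons x v =1 scons x w.
Proof. by move=> E []. Qed.

(** Argument lists are functions, and pointwise equality does not give equality, so this invariance
    is obtained by induction on [PR]. *)
Lemma PR_eq f v w : PR f -> v =1 w -> f v = f w.
Proof.
move=> H; elim: H v w => {f}.
- by move=> k v w ->.
- by [].
- by move=> f _ IH v w E; rewrite (IH _ _ E).
- move=> f g _ IHf _ IHg v w E; rewrite (IHg _ _ E); apply: IHf.
  exact: eq_scons.
- by move=> r f _ IH v w E; apply: IH => k.
- move=> n a f _ IHn _ IHa _ IHf v w E; rewrite (IHn _ _ E) (IHa _ _ E).
  by apply: eq_prec => k x; apply: IHf; do 2!apply: eq_scons.
by move=> f g E _ IH v w Ev; rewrite -!E; apply: IH.
Qed.

Section PRcompile.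
Variable Sigma : finType.

(** Registers below [b] are protected: they hold the arguments, located by [rho], and the
    intermediate results so far. The result goes to [b], scratch values above it. *)
Lemma PR_pure f : PR f -> forall (rho : nat -> nat) b, (forall k, rho k < b) ->
  exists c, forall s, exists s', [/\ pure Sigma c s s',
    s' b = f (fun k => s (rho k)) & forall r, r < b -> s' r = s r].
Proof.
elim=> {f}.
- move=> k rho b lt; exists (Copy (rho k) b b.+1) => s.
  have ltk := lt k; have [|||s' [H E K]] := @pure_copy Sigma (rho k) b b.+1 s; try lia.
  by exists s'; split=> // r ltr; apply: K; lia.
- move=> rho b lt; exists (Clear b) => s; have [s' [H E K]] := pure_clear Sigma b s.
  by exists s'; split=> // r ltr; apply: K; lia.
- move=> f _ IH rho b lt; have [c Hc] := IH rho b lt; exists (Seq c (Inc b)) => s.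
  have [s' [H E K]] := Hc s; exists (incr b s'); split.
  + by apply: pure_seq H _; constructor.
  + by rewrite /incr /upd eqxx E.
  by move=> r ltr; rewrite /incr /upd ltn_eqF // K.
- move=> f g Hf IHf _ IHg rho b lt; have [cg Hg] := IHg rho b lt.
  have [|cf Hcf] := IHf (scons b rho) b.+1; first by case=> [|k] //=; apply: leqW.
  exists (Seq cg (Seq cf (Move b.+1 b))) => s.
  have [s1 [H1 E1 K1]] := Hg s; have [s2 [H2 E2 K2]] := Hcf s1.
  have [|s3 [H3 _ E3 K3]] := @pure_move Sigma b.+1 b s2; first lia.
  exists s3; split; first exact: pure_seq H1 (pure_seq H2 H3).
    rewrite E3 E2; apply: PR_eq Hf _; case=> [|k] //=; exact: K1.
  by move=> r ltr; rewrite K3 ?K2 ?K1 //; lia.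
- by move=> r f _ IH rho b lt; apply: (IH (fun k => rho (r k))).
- move=> n a f _ IHn HaPR IHa Hf IHf rho b lt.
  have [cn Hn] := IHn rho b lt.
  have [|ca Ha] := IHa rho b.+1; first by move=> k; apply: leqW.
  have [|cf Hcf] := IHf (scons b.+1 (scons b.+2 rho)) b.+3.
    by case=> [|[|k]] //=; have := lt k; lia.
  (* Register [b] counts the iterations left, [b.+1] holds the accumulated value, [b.+2] the index,
     and [b.+3] receives the result of the body. *)
  exists (Seq cn (Seq ca (Seq (Clear b.+2) (Seq
    (While b (Seq cf (Seq (Move b.+3 b.+1) (Inc b.+2)))) (Move b.+1 b))))) => s.
  have [s1 [H1 E1 K1]] := Hn s; have [s2 [H2 E2 K2]] := Ha s1.
  have [s3 [H3 E3 K3]] := pure_clear Sigma b.+2 s2.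
  set v := fun k => s (rho k).
  have := @pure_while Sigma b (Seq cf (Seq (Move b.+3 b.+1) (Inc b.+2)))
    (fun m s' => [/\ s' b.+2 + m = n v,
       s' b.+1 = prec (s' b.+2) (a v) (fun k x => f (scons x (scons k v)))
       & forall r, r < b -> s' r = s r]) s3.
  have Eb : s3 b = n v by rewrite K3 ?K2 //; lia.
  case=> [m t Et [I1 I2 I3]||s4 [H4 E4 [I1 I2 I3]]].
  + have [t1 [F1 D1 L1]] := Hcf (upd t b m).
    have [|t2 [F2 _ D2 L2]] := @pure_move Sigma b.+3 b.+1 t1; first lia.
    have Ex : f (fun k => upd t b m (scons b.+1 (scons b.+2 rho) k)) =
        prec (t b.+2).+1 (a v) (fun k x => f (scons x (scons k v))).
      rewrite /= -I2; apply: PR_eq Hf _; case=> [|[|k]] /=; rewrite /upd.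
      * by have -> : (b.+1 == b) = false by lia.
      * by have -> : (b.+2 == b) = false by lia.
      by rewrite ltn_eqF // I3.
    exists (incr b.+2 t2); split.
    * by apply: pure_seq F1 (pure_seq F2 _); constructor.
    * by rewrite /incr /upd ltn_eqF // L2 ?L1 /upd ?eqxx //; lia.
    have E2t : t2 b.+2 = t b.+2.
      by rewrite L2 ?L1 /upd; try lia; case: eqP; lia.
    split.
    * by rewrite /incr /upd eqxx E2t; lia.
    * rewrite /incr /upd eqxx E2t; have -> : (b.+1 == b.+2) = false by lia.
      by rewrite D2 D1.
    move=> r ltr; rewrite /incr /upd; have -> : (r == b.+2) = false by lia.
    by rewrite L2 ?L1 /upd ?ltn_eqF ?I3 //; lia.
  + rewrite E3 Eb; split=> //.
      rewrite K3 /=; last lia.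
      by rewrite E2; apply: PR_eq HaPR _ => k; rewrite K1.
    by move=> r ltr; rewrite K3 ?K2 ?K1 //; lia.
  have [|s5 [H5 _ E5 K5]] := @pure_move Sigma b.+1 b s4; first lia.
  exists s5; split.
  + exact: pure_seq H1 (pure_seq H2 (pure_seq H3 (pure_seq H4 H5))).
  + by rewrite E5 I2; congr prec; lia.
  by move=> r ltr; rewrite K5 ?I3 //; lia.
move=> f g E _ IH rho b lt; have [c Hc] := IH rho b lt.
by exists c => s; have [s' [H E1 K]] := Hc s; exists s'; rewrite -E.
Qed.

End PRcompile.

(** * Closure properties of primitive recursive functions *)

Lemma PR_drop f : PR f -> PR (fun v => f (fun k => v k.+1)).
Proof. exact: PR_ren. Qed.

Lemma PR_app1 F f : PR (fun v => F (v 0)) -> PR f -> PR (fun v => F (f v)).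
Proof. by move=> HF Hf; apply: (PR_let HF Hf). Qed.

Lemma PR_app2 F f g : PR (fun v => F (v 0) (v 1)) -> PR f -> PR g ->
  PR (fun v => F (f v) (g v)).
Proof. by move=> HF Hf Hg; apply: (PR_let (PR_let HF (PR_drop Hf)) Hg). Qed.

Lemma PR_prec n a (f : (nat -> nat) -> nat -> nat -> nat) :
    PR n -> PR a -> PR (fun u => f (fun k => u k.+2) (u 1) (u 0)) ->
  PR (fun v => prec (n v) (a v) (f v)).
Proof. by move=> Hn Ha Hf; apply: (PR_prec0 Hn Ha Hf). Qed.

Lemma PR_const n : PR (fun=> n).
Proof. by elim: n => [|n IH]; [apply: PR_zero|apply: PR_succ IH]. Qed.

Lemma PR_add f g : PR f -> PR g -> PR (fun v => f v + g v).
Proof.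
apply: PR_app2; apply: (@PR_ext (fun v => prec (v 0) (v 1) (fun _ x => x.+1))).
  by move=> v; elim: (v 0) => //= n ->.
by apply: PR_prec; do ?apply: PR_succ; apply: PR_var.
Qed.

Lemma PR_mul f g : PR f -> PR g -> PR (fun v => f v * g v).
Proof.
apply: PR_app2; apply: (@PR_ext (fun v => prec (v 0) 0 (fun _ x => v 1 + x))).
  by move=> v; elim: (v 0) => //= n ->.
apply: PR_prec; [exact: PR_var|exact: PR_zero|].
by apply: PR_add; apply: PR_var.
Qed.

Lemma PR_pred f : PR f -> PR (fun v => (f v).-1).
Proof.
apply: PR_app1; apply: (@PR_ext (fun v => prec (v 0) 0 (fun k _ => k))).
  by move=> v; case: (v 0).
by apply: PR_prec; [exact: PR_var|exact: PR_zero|exact: PR_var].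
Qed.

Lemma PR_sub f g : PR f -> PR g -> PR (fun v => f v - g v).
Proof.
apply: PR_app2; apply: (@PR_ext (fun v => prec (v 1) (v 0) (fun _ x => x.-1))).
  by move=> v; elim: (v 1) => [|n /= ->]; [rewrite subn0|rewrite subnS].
by apply: PR_prec; try apply: PR_pred; apply: PR_var.
Qed.

(** A truth value, read as 0 or 1, serves as the number of recursion steps. *)
Lemma PR_if (b : (nat -> nat) -> bool) f g : PR b -> PR f -> PR g ->
  PR (fun v => if b v then f v else g v).
Proof.
move=> Hb Hf Hg; apply: (@PR_ext (fun v => prec (b v) (g v) (fun _ _ => f v))).
  by move=> v; case: (b v).
by apply: PR_prec => //; apply: (PR_drop (PR_drop Hf)).
Qed.

Lemma PR_not (b : (nat -> nat) -> bool) : PR b -> PR (fun v => ~~ b v).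
Proof.
move=> Hb; apply: (@PR_ext (fun v => if b v then 0 else 1)); first by move=> v; case: (b v).
by apply: PR_if => //; apply: PR_const.
Qed.

Lemma PR_eqn f g : PR f -> PR g -> PR (fun v => f v == g v).
Proof.
move=> Hf Hg.
apply: (@PR_ext (fun v => prec ((f v - g v) + (g v - f v)) 1 (fun _ _ => 0))).
  move=> v; case: eqP => [->|N]; first by rewrite subnn.
  by case E : (_ + _) => //; lia.
apply: PR_prec; [|exact: PR_const|exact: PR_const].
by apply: PR_add; apply: PR_sub.
Qed.

Lemma PR_has n (p : (nat -> nat) -> nat -> bool) :
    PR n -> PR (fun u => p (fun k => u k.+1) (u 0)) ->
  PR (fun v => has (p v) (iota 0 (n v))).
Proof.
move=> Hn Hp.
apply: (@PR_ext (fun v => prec (n v) 0 (fun k x => if p v k then 1 else x))).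
  move=> v; elim: (n v) => // m IH.
  by rewrite -{2}[m.+1]addn1 iotaD cats1 has_rcons /= IH; case: (p v m).
apply: PR_prec => //; first exact: PR_zero.
by apply: PR_if; [apply: (PR_drop Hp)|exact: PR_const|exact: PR_var].
Qed.

(** * Numerical codes of pairs and lists *)

Definition ncons x y := ((x + y) * (x + y) + x).+1.

(** With s = x + y, the number s ^ 2 + x is at least s ^ 2 and below (s + 1) ^ 2, which determines
    s, then x and y. The successor in [ncons] leaves 0 free for the empty list. *)
Lemma ncons_inj x y x' y' : ncons x y = ncons x' y' -> x = x' /\ y = y'.
Proof.
rewrite /ncons => -[E].
have S : x + y = x' + y'.
  by case: (ltngtP (x + y) (x' + y')) => // lt; nia.
by rewrite S in E; lia.
Qed.

Lemma ncons_mono x y x' y' : x <= x' -> y <= y' -> ncons x y <= ncons x' y'.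
Proof.
by move=> lx ly; rewrite /ncons ltnS; apply: leq_add => //; apply: leq_mul; apply: leq_add.
Qed.

Lemma ltn_nconsl x y : x < ncons x y.
Proof. rewrite /ncons; nia. Qed.

Lemma ltn_nconsr x y : y < ncons x y.
Proof. rewrite /ncons; nia. Qed.

Lemma PR_ncons f g : PR f -> PR g -> PR (fun v => ncons (f v) (g v)).
Proof.
move=> Hf Hg; apply: PR_succ; apply: PR_add => //.
by apply: PR_mul; apply: PR_add.
Qed.

(** Both components of a pair are smaller than its code, so a bounded search inverts [ncons]
    primitive recursively. *)
Definition hd m :=
  prec m 0 (fun k x => if has (fun y => m == ncons k y) (iota 0 m) then k else x).
Definition tl m :=
  prec m 0 (fun k x => if has (fun y => m == ncons y k) (iota 0 m) then k else x).

Lemma PR_hd f : PR f -> PR (fun v => hd (f v)).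
Proof.
apply: PR_app1; apply: PR_prec; [exact: PR_var|exact: PR_zero|].
apply: PR_if; [|exact: PR_var|exact: PR_var]; apply: PR_has; first exact: PR_var.
by apply: PR_eqn; [|apply: PR_ncons]; apply: PR_var.
Qed.

Lemma PR_tl f : PR f -> PR (fun v => tl (f v)).
Proof.
apply: PR_app1; apply: PR_prec; [exact: PR_var|exact: PR_zero|].
apply: PR_if; [|exact: PR_var|exact: PR_var]; apply: PR_has; first exact: PR_var.
by apply: PR_eqn; [|apply: PR_ncons]; apply: PR_var.
Qed.

Lemma prec_search n (p : pred nat) k : k < n -> (forall j, p j = (j == k)) ->
  prec n 0 (fun j x => if p j then j else x) = k.
Proof.
move=> lt H; elim: n lt => // n IH; rewrite ltnS leq_eqVlt /= H.
by case: eqP => [->|_ /IH]; [rewrite eqxx|case: eqP].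
Qed.

Lemma hd_ncons x y : hd (ncons x y) = x.
Proof.
apply: prec_search => [|j]; first exact: ltn_nconsl.
apply/hasP/eqP => [[z _ /eqP/ncons_inj[->]]//|->].
by exists y => //; rewrite mem_iota ltn_nconsr.
Qed.

Lemma tl_ncons x y : tl (ncons x y) = y.
Proof.
apply: prec_search => [|j]; first exact: ltn_nconsr.
apply/hasP/eqP => [[z _ /eqP/ncons_inj[_ ->]]//|->].
by exists x => //; rewrite mem_iota ltn_nconsl.
Qed.

Definition lcode (s : seq nat) := foldr ncons 0 s.

Lemma size_lcode s : size s <= lcode s.
Proof. by elim: s => //= x s IH; apply: leq_ltn_trans IH (ltn_nconsr _ _). Qed.

Definition ltail l k := prec k l (fun _ z => tl z).
Definition field k l := hd (ltail l k).
(** A list is no longer than its code, so [l] rounds suffice; those after the end of the list change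
    nothing. *)
Definition lfold (f : nat -> nat -> nat) x0 l :=
  prec l x0 (fun k x => if ltail l k == 0 then x else f x (field k l)).

Lemma ltail_lcode s k : ltail (lcode s) k = lcode (drop k s).
Proof.
elim: k => [|k IH]; first by rewrite drop0.
rewrite /ltail /= -/(ltail _ _) IH.
by elim: s k {IH} => [|x s IH] [|k] //=; rewrite ?tl_ncons ?drop0.
Qed.

Lemma field_lcode s k : field k (lcode s) = nth 0 s k.
Proof.
rewrite /field ltail_lcode; elim: s k => [|x s IH] [|k] //=; exact: hd_ncons.
Qed.

Lemma lfold_lcode f x0 s : lfold f x0 (lcode s) = foldl f x0 s.
Proof.
have H n : prec n x0 (fun k x => if ltail (lcode s) k == 0 then x
    else f x (field k (lcode s))) = foldl f x0 (take n s).
  elim: n => [|n /= ->]; first by rewrite take0.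
  rewrite ltail_lcode field_lcode; have [le|lt] := leqP (size s) n.
    by rewrite drop_oversize // !take_oversize // ltnW.
  by rewrite (drop_nth 0 lt) (take_nth 0 lt) foldl_rcons.
by rewrite /lfold H take_oversize // size_lcode.
Qed.

Lemma PR_ltail f g : PR f -> PR g -> PR (fun v => ltail (f v) (g v)).
Proof. by apply: PR_app2; apply: PR_prec; try apply: PR_tl; apply: PR_var. Qed.

Lemma PR_field f g : PR f -> PR g -> PR (fun v => field (f v) (g v)).
Proof. by move=> Hf Hg; apply: PR_hd; apply: PR_ltail. Qed.

Lemma PR_lfold x l (f : (nat -> nat) -> nat -> nat -> nat) :
    PR x -> PR l -> PR (fun u => f (fun k => u k.+2) (u 1) (u 0)) ->
  PR (fun v => lfold (f v) (x v) (l v)).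
Proof.
move=> Hx Hl Hf; apply: PR_prec => //.
have Hl2 := PR_drop (PR_drop Hl).
apply: PR_if; [|exact: PR_var|].
  by apply: PR_eqn; [apply: PR_ltail => //; apply: PR_var|exact: PR_zero].
have H0 : PR (fun u => field (u 1) (l (fun k => u k.+2))).
  by apply: PR_field => //; apply: PR_var.
(* The current element is pushed in front, so the loop counter sits at position 2, which the
   renaming skips. *)
exact: (PR_let (PR_ren (fun k => if k is j.+2 then j.+3 else k) Hf) H0).
Qed.

(** * Words as numbers, and Turing machines for primitive recursive predicates *)

Definition wcode (Sigma : finType) (w : seq Sigma) : nat :=
  lcode [seq nat_of_ord (enum_rank a) | a <- w].

Definition lrev l := lfold (fun x a => ncons a x) 0 l.

Lemma lrev_lcode s : lrev (lcode s) = lcode (rev s).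
Proof. by rewrite /lrev lfold_lcode -{1}[s]revK foldl_rev. Qed.

Lemma PR_lrev f : PR f -> PR (fun v => lrev (f v)).
Proof.
apply: PR_app1; apply: PR_lfold; [exact: PR_zero|exact: PR_var|].
by apply: PR_ncons; apply: PR_var.
Qed.

Section Semidecide.
Variable Sigma : finType.

Lemma iter_incr n r s x : iter n (incr r) s x =
  if x == r then n + s r else s x.
Proof.
elim: n x => [|n IH] x /=; first by case: (x =P r) => [->|].
by rewrite {1}/incr /upd !IH eqxx; case: (x == r).
Qed.

(* The word is reversed because its first letter is read, hence pushed, first. *)
Lemma exec_read_input : exists c, forall (s : nat -> nat) (w : seq Sigma), s =1 (fun=> 0) ->
  exists2 s', exec c s w s' [::] & s' 0 = wcode (rev w).
Proof.
have [|c Hc] := PR_pure Sigma (PR_ncons (PR_var 1) (PR_var 0)) (rho := fun k => minn k 1) (b := 2).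
  by move=> k; rewrite ltnS geq_minr.
pose body := Seq c (Seq (Move 2 0) (Seq (Clear 1) (Read 1))).
exists (Seq (Read 1) (While 1 body)) => s w s0.
(* [Read] leaves the rank plus one in register 1 and the loop subtracts one, so the body starts with
   the rank itself; a 0 at the end of the input stops the loop. *)
suff H (w' : seq Sigma) s1 : s1 1 = 0 -> exists2 s',
    exec (While 1 body) (iter (rnext w') (incr 1) s1) (behead w') s' [::] &
    s' 0 = foldl (fun x a => ncons (enum_rank a) x) (s1 0) w'.
  have [|s' H1 E1] := H w s; first by rewrite s0.
  exists s'; first by apply: ExSeq H1; constructor.
  by rewrite E1 s0 -{1}[w]revK foldl_rev /wcode; elim: (rev w) => //= a v ->.
elim: w' s1 => [|a w' IH] s1 E1; first by exists s1 => //; constructor.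
set t := iter _ _ _; have Et : t 1 = (enum_rank a).+1 by rewrite /t iter_incr E1 addn0.
have [t1 [H1 D1 K1]] := Hc (upd t 1 (enum_rank a)).
have [|t2 [H2 _ D2 K2]] := @pure_move Sigma 2 0 t1; first by [].
have [t3 [H3 D3 K3]] := pure_clear Sigma 1 t2.
have [s' H' E'] := IH t3 D3; exists s'.
  apply: ExWhileS Et _ H'; apply: ExSeq (H1 _) _; apply: ExSeq (H2 _) _.
  by apply: ExSeq (H3 _) _; constructor.
by rewrite E' K3 // D2 D1 /= /upd /= /t iter_incr.
Qed.

Lemma RE_PR (p : nat -> bool) : PR (fun v => p (v 0)) ->
  RE (fun w : seq Sigma => p (wcode w)).
Proof.
move=> Hp; have [c1 H1] := exec_read_input.
have Hq : PR (fun v => p (lrev (v 0))).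
  exact: (PR_app1 (F := fun x => p x) Hp (PR_lrev (PR_var 0))).
have [//|c2 H2] := PR_pure Sigma Hq (rho := fun=> 0) (b := 1).
pose b := compile Sigma (Seq c1 c2) 0.
(* If the result is 0, the jump goes past the end of the program, hence to rejection; otherwise
   control falls through to [HALT true]. *)
exists (cTM (b ++ [:: DEC 1 (size b).+2; HALT true])) => w.
have [//|s1 F1 E1] := H1 (fun=> 0) w; have [s2 [F2 E2 _]] := H2 s1.
have := exec_goes [::] [:: DEC 1 (size b).+2; HALT true] (ExSeq F1 (F2 _)).
rewrite cat0s -/b add0n => G.
have {E2} E2 : s2 1 = p (wcode w) by rewrite E2 E1 lrev_lcode -map_rev revK.
case Ep : (p (wcode w)) E2 => E2.
- apply: iff_sym; apply: (@cTM_accepts _ _ w (size b).+1 (upd s2 1 0) [::] true).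
    apply: goes_trans G _.
    apply: (GoDecS (r := 1) (l := (size b).+2) (n := 0) _ E2); last by constructor.
    exact: at_pc_cat.
  by rewrite /at_pc nth_cat ltnNge leqnSn subSnn.
apply: iff_sym; apply: (@cTM_accepts _ _ w (size b).+2 s2 [::] false).
  apply: goes_trans G _; apply: (GoDec0 (r := 1) (l := (size b).+2) _ E2); last by constructor.
  exact: at_pc_cat.
by rewrite /at_pc nth_default // size_cat addn2.
Qed.

End Semidecide.

(** * The universal checker *)

Definition push (l : letter) (X : seq letter) :=
  if X is l' :: X' then if l' == linv l then X' else l :: X else [:: l].

Lemma freeredE w : freered w = foldr push [::] w.
Proof. by elim: w => //= l w <-; case: (freered w). Qed.

Lemma linvK : involutive linv.
Proof. by case=> a b; rewrite /linv /= negbK. Qed.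

Lemma reduced_push l X : reduced X -> reduced (push l X).
Proof.
case: X => //= l' X; case: eqP => [_|/eqP N] H; last by rewrite /= N.
exact: (@reduced_behead l').
Qed.

Lemma reduced_foldr_push Z u : reduced Z -> reduced (foldr push Z u).
Proof. by move=> HZ; elim: u => //= l u; apply: reduced_push. Qed.

Lemma push_linv l X : reduced X -> push l (push (linv l) X) = X.
Proof.
case: X => [|l' X] /=; first by rewrite eqxx.
rewrite linvK; case: eqP => [->|_]; last by rewrite /= eqxx.
by case: X => //= l2 X /andP[/negbTE ->].
Qed.

Lemma freered_id w : reduced w -> freered w = w.
Proof.
elim: w => //= l w IH H; rewrite IH; last exact: reduced_behead H.
by case: w H {IH} => //= l' w /andP[/negbTE ->].
Qed.

(** On reduced words the actions of a letter and of its inverse cancel, so the action of a word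
    depends only on its free reduction. *)
Lemma foldr_push_freered Z u : reduced Z -> foldr push Z (freered u) = foldr push Z u.
Proof.
move=> HZ; rewrite freeredE; elim: u => //= l u <-.
case: (foldr push [::] u) => //= l' X; case: eqP => // ->.
by rewrite push_linv // reduced_foldr_push.
Qed.

Lemma freered_cat_foldr u Z : reduced Z -> freered (u ++ Z) = foldr push Z u.
Proof. by move=> HZ; rewrite freeredE foldr_cat -freeredE freered_id. Qed.

(** Associativity in the form (x m) Z = x (m Z): it transfers a register update to the part of the
    run already executed backwards. *)
Lemma freered_mul (x m : F2) Z : reduced Z ->
  freered (val (F2mul x m) ++ Z) = freered (val x ++ foldr push Z (val m)).
Proof.
move=> HZ; rewrite !freered_cat_foldr ?reduced_foldr_push // foldr_push_freered //.
by rewrite foldr_cat.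
Qed.

Definition lnum (l : letter) : nat := 2 * l.1 + l.2.
Definition linvn n := if n == 0 then 1 else if n == 1 then 0 else if n == 2 then 3 else 2.

Lemma lnum_inj : injective lnum.
Proof. by case=> [[] []] [[] []]. Qed.

Lemma linvn_lnum l : linvn (lnum l) = lnum (linv l).
Proof. by case: l => [[] []]. Qed.

Definition pushn X l :=
  if X == 0 then ncons l X else if hd X == linvn l then tl X else ncons l X.

Definition mcode (w : seq letter) := lcode [seq lnum l | l <- w].

Lemma pushn_mcode X l : pushn (mcode X) (lnum l) = mcode (push l X).
Proof.
case: X => [|l' X] //=; rewrite /pushn hd_ncons tl_ncons linvn_lnum (inj_eq lnum_inj) /=.
by case: eqP.
Qed.

Definition mulc X m := lfold pushn X m.

(** The fold consumes its list from the left, whereas the last letter of [w] acts first; hence the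
    reversal. *)
Lemma mulc_mcode X w : mulc (mcode X) (mcode (rev w)) = mcode (foldr push X w).
Proof.
rewrite /mulc lfold_lcode map_rev foldl_rev.
by elim: w => //= l w ->; rewrite pushn_mcode.
Qed.

Lemma lcode_inj : injective lcode.
Proof. by elim=> [|x s IH] [|y t] // /ncons_inj[-> E]; rewrite (IH _ E). Qed.

Lemma mcode_inj : injective mcode.
Proof. by move=> X Y /lcode_inj /(inj_map lnum_inj). Qed.

Lemma wcode_inj (Sigma : finType) : injective (@wcode Sigma).
Proof.
by move=> w w' /lcode_inj; apply: inj_map => a b /val_inj /enum_rank_inj.
Qed.

(* A transition is coded as [src; tgt; letter; m1; m2] and a configuration as
   [state; word; register 1; register 2]; runs are executed from their last
   transition to the first one, so that letters and group elements are added on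
   the left. A configuration whose state is [0] is dead. *)
Definition ustep e c j :=
  let t := field j e in
  if field 0 c == field 1 t then
    lcode [:: field 0 t; lfold (fun x a => ncons a x) (field 1 c) (field 2 t);
              mulc (field 2 c) (field 3 t); mulc (field 3 c) (field 4 t)]
  else 0.

(** State 1 is a common end placed after the accepting states and state 2 a start placed before the
    initial state; a complete backward run leads from 1 to 2. *)
Definition urun e N := lfold (ustep e) (lcode [:: 1; 0; 0; 0]) N.

(** This is the code of the list of [l] copies of [b]; as [ncons] is monotone, it bounds the codes
    of the runs to be searched. *)
Definition lbound l b := prec l 0 (fun _ z => ncons b z).

Definition ucheck e l b x :=
  has (fun N => urun e N == lcode [:: 2; x; 0; 0]) (iota 0 (lbound l b).+1).

Lemma lbound_lcode l b s : size s <= l -> all (fun j => j < b) s -> lcode s <= lbound l b.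
Proof.
elim: l s => [|l IH] [|j s] //= le /andP[lt H].
by apply: ncons_mono; [apply: ltnW|apply: IH].
Qed.

Lemma PR_linvn f : PR f -> PR (fun v => linvn (f v)).
Proof.
move=> Hf; apply: PR_if; [by apply: PR_eqn => //; apply: PR_const|exact: PR_const|].
apply: PR_if; [by apply: PR_eqn => //; apply: PR_const|exact: PR_const|].
apply: PR_if; [by apply: PR_eqn => //; apply: PR_const|exact: PR_const|exact: PR_const].
Qed.

Lemma PR_pushn f g : PR f -> PR g -> PR (fun v => pushn (f v) (g v)).
Proof.
move=> Hf Hg; apply: PR_if; [by apply: PR_eqn => //; apply: PR_zero|exact: PR_ncons|].
apply: PR_if; [|exact: PR_tl|exact: PR_ncons].
by apply: PR_eqn; [apply: PR_hd|apply: PR_linvn].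
Qed.

Lemma PR_mulc f g : PR f -> PR g -> PR (fun v => mulc (f v) (g v)).
Proof. by move=> Hf Hg; apply: PR_lfold => //; apply: PR_pushn; apply: PR_var. Qed.

Lemma PR_ustep e c j : PR e -> PR c -> PR j -> PR (fun v => ustep (e v) (c v) (j v)).
Proof.
move=> He Hc Hj; have Ht k := PR_field (PR_const k) (PR_field Hj He).
have Hk k := PR_field (PR_const k) Hc.
apply: PR_if; [exact: PR_eqn|do !apply: PR_ncons|exact: PR_zero] => //.
- by apply: PR_lfold => //; apply: PR_ncons; apply: PR_var.
- exact: PR_mulc.
- exact: PR_mulc.
exact: PR_zero.
Qed.

Lemma PR_ucheck e l b x : PR e -> PR l -> PR b -> PR x ->
  PR (fun v => ucheck (e v) (l v) (b v) (x v)).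
Proof.
move=> He Hl Hb Hx; apply: PR_has.
  apply: PR_succ; apply: PR_prec => //; first exact: PR_zero.
  by apply: PR_ncons; [apply: (PR_drop (PR_drop Hb))|apply: PR_var].
apply: PR_eqn.
  apply: PR_lfold; [exact: PR_const|exact: PR_var|].
  by apply: PR_ustep; [apply: (PR_drop (PR_drop (PR_drop He)))|exact: PR_var|exact: PR_var].
do !apply: PR_ncons; try exact: PR_const; exact: (PR_drop Hx).
Qed.

Lemma lfold_ind (p : nat -> Prop) f x0 l :
  p x0 -> (forall x j, p x -> p (f x j)) -> p (lfold f x0 l).
Proof.
by move=> H0 H; rewrite /lfold; elim: {1}l => //= n IH; case: ifP => // _; apply: H.
Qed.

Lemma In_map_mem (T : Type) (U : eqType) (f : T -> U) s y :
  y \in map f s <-> exists2 x, List.In x s & y = f x.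
Proof.
elim: s => [|x s IH] /=; first by split=> // -[].
rewrite inE; split=> [/orP[/eqP ->|/IH [z zs ->]]|[z [<- ->|zs Ey]]].
- by exists x; [left|].
- by exists z; [right|].
- by rewrite eqxx.
by apply/orP; right; apply/IH; exists z.
Qed.

(** * Soundness and completeness of the checker *)

Section Universal.
Variables (Sigma : finType) (A : Gautomaton F2xF2 Sigma).

(** The shift reserves 0, 1 and 2 for the dead, end and start states. *)
Definition qc (q : gQ A) := (enum_rank q).+3.
Definition ocode (o : option Sigma) := if o is Some a then [:: a] else [::].
Definition trans s t (o : seq Sigma) (m1 m2 : seq letter) :=
  lcode [:: s; t; wcode o; mcode (rev m1); mcode (rev m2)].
Definition tr q o (qm : gQ A * F2xF2) :=
  trans (qc q) (qc qm.1) (ocode o) (val qm.2.1) (val qm.2.2).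

Definition table :=
  trans 2 (qc (gq0 A)) [::] [::] [::]
  :: [seq trans (qc q) 1 [::] [::] [::] | q <- enum (gQ A) & gacc q]
  ++ flatten [seq [seq tr q o qm | qm <- gdelta q o] | q <- enum (gQ A), o <- enum {: option Sigma}].

Lemma tableP t : t \in table <->
  [\/ t = trans 2 (qc (gq0 A)) [::] [::] [::],
      exists2 q, gacc q & t = trans (qc q) 1 [::] [::] [::]
    | exists q o qm, List.In qm (gdelta q o) /\ t = tr q o qm].
Proof.
rewrite inE mem_cat; split.
  case/or3P=> [/eqP ->|/mapP[q]|/flattenP[_ /allpairsP[[q o] /= [_ _ ->]]]].
  - by constructor 1.
  - by rewrite mem_filter => /andP[aq _ ->]; constructor 2; exists q.
  by case/In_map_mem => qm H ->; constructor 3; exists q, o, qm.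
case=> [->|[q aq ->]|[q [o [qm [H ->]]]]]; first by rewrite eqxx.
  by apply/or3P; constructor 2; apply: map_f; rewrite mem_filter aq mem_enum.
apply/or3P; constructor 3; apply/flattenP; exists [seq tr q o qm | qm <- gdelta q o].
  by apply: allpairs_f; rewrite mem_enum.
by apply/In_map_mem; exists qm.
Qed.

Definition conf q w Z1 Z2 := lcode [:: q; @wcode Sigma w; mcode Z1; mcode Z2].

(** Folding [ncons] over the letters prepends them in reverse order, which agrees with [o ++ w] as
    [o] has at most one letter. *)
Lemma ustep_conf j q w Z1 Z2 s t o m1 m2 : nth 0 table j = trans s t o m1 m2 -> size o <= 1 ->
  ustep (lcode table) (conf q w Z1 Z2) j =
  if q == t then conf s (o ++ w) (foldr push Z1 m1) (foldr push Z2 m2) else 0.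
Proof.
move=> Ej So; rewrite /ustep field_lcode Ej !field_lcode /=; case: eqP => // _.
rewrite !mulc_mcode lfold_lcode /conf; congr (lcode [:: _; _; _; _]).
by case: o So {Ej} => [|a []].
Qed.

Definition acc_from := accepting_from F2xF2mul F2xF2e (A := A).

(** A backward run knows only the product Z of the group elements still to be multiplied, so the
    invariant speaks of every register content x with x Z = e. *)
Inductive sound (c : nat) : Prop :=
  | SoundDead of field 0 c = 0
  | SoundEnd of c = conf 1 [::] [::] [::]
  | SoundRun q w Z1 Z2 of reduced Z1 & reduced Z2 & c = conf (qc q) w Z1 Z2 &
      forall x, freered (val x.1 ++ Z1) = [::] -> freered (val x.2 ++ Z2) = [::] ->
        exists k, acc_from q x w k
  | SoundStart w Z1 Z2 of c = conf 2 w Z1 Z2 &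
      (Z1 = [::] -> Z2 = [::] -> gaccepts F2xF2mul F2xF2e A w).

Lemma field0 k : field k 0 = 0.
Proof. by rewrite (field_lcode [::]) nth_nil. Qed.

Lemma sound_ustep c j : sound c -> sound (ustep (lcode table) c j).
Proof.
move=> Sc; have [lt|le] := ltnP j (size table); last first.
  (* An index outside the table reads the default 0, which acts as a transition from state 0 to
     state 0. *)
  apply: SoundDead; rewrite /ustep field_lcode (nth_default _ le) !field0.
  by case: eqP; rewrite ?field_lcode ?field0.
(* No transition of the table leads into state 0, so dead configurations stay dead. *)
have t0 : field 1 (nth 0 table j) != 0.
  by case/tableP: (mem_nth 0 lt) => [->|[q _ ->]|[q [o [qm [_ ->]]]]];
    rewrite (field_lcode [:: _; _; _; _; _]).
case: Sc => [c0|Ec|q w Z1 Z2 R1 R2 Ec H|w Z1 Z2 Ec _].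
- apply: SoundDead; rewrite /ustep c0 field_lcode eq_sym (negbTE t0).
  exact: field0.
- rewrite Ec; case/tableP: (mem_nth 0 lt) => [E|[q aq E]|[q [o [qm [_ E]]]]].
  + by rewrite (ustep_conf _ _ _ _ E) //; apply: SoundDead; rewrite field0.
  + rewrite (ustep_conf _ _ _ _ E) //= ; apply: (@SoundRun _ q [::] [::] [::]) => // -[x1 x2] /=.
    rewrite !cats0 !freered_id ?(valP x1) ?(valP x2) // => E1 E2; exists 0.
    by apply: AccEnd => //; congr (_, _); apply: val_inj.
  + by rewrite (ustep_conf _ _ _ _ E) ?leq_b1 //; [apply: SoundDead; rewrite field0|case: (o)].
- rewrite Ec; case/tableP: (mem_nth 0 lt) => [E|[q' aq E]|[q' [o [[q1 [m1 m2]] [Hin E]]]]].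
  + rewrite (ustep_conf _ _ _ _ E) //=; case: eqP => [|_]; last by apply: SoundDead; rewrite field0.
    move=> [/val_inj /enum_rank_inj Eq]; apply: SoundStart => // E1 E2.
    by rewrite /gaccepts -Eq; apply: H; rewrite ?E1 ?E2.
  + by rewrite (ustep_conf _ _ _ _ E) //; apply: SoundDead; rewrite field0.
  rewrite (ustep_conf _ _ _ _ E); last by case: (o).
  case: eqP => [|_]; last by apply: SoundDead; rewrite field0.
  move=> [/val_inj /enum_rank_inj Eq]; rewrite -{}Eq in Hin {E}.
  apply: SoundRun => //; try exact: reduced_foldr_push.
  move=> x; rewrite /= -!freered_mul // => F1 F2.
  have [k Hk] := H (F2xF2mul x (m1, m2)) F1 F2.
  by exists k.+1; case: o Hin => [a|] Hin; [apply: AccSym Hin Hk|apply: AccEps Hin Hk].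
by rewrite Ec; case/tableP: (mem_nth 0 lt) => [E|[q aq E]|[q [o [qm [_ E]]]]];
  rewrite (ustep_conf _ _ _ _ E) //; try (by apply: SoundDead; rewrite field0); case: (o).
Qed.

Lemma ucheck_sound l b w :
  ucheck (lcode table) l b (wcode w) -> gaccepts F2xF2mul F2xF2e A w.
Proof.
case/hasP=> N _ /eqP EN.
have : sound (urun (lcode table) N).
  by apply: lfold_ind => [|x j]; [apply: SoundEnd|apply: sound_ustep].
rewrite EN; case=> [|/lcode_inj//|q w' Z1 Z2 _ _ /lcode_inj//|w' Z1 Z2 /lcode_inj[]].
  by rewrite field_lcode.
by move=> /wcode_inj -> E1 E2; apply; apply: mcode_inj.
Qed.

(** The list has [k.+1] entries: the transition into the end state, then the [k] transitions of the
    run in backward order. *)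
Definition traced q (x : F2xF2) w k := exists js Z1 Z2,
  [/\ size js = k.+1, all (fun j => j < size table) js, reduced Z1 && reduced Z2,
      freered (val x.1 ++ Z1) = [::] /\ freered (val x.2 ++ Z2) = [::]
    & foldl (ustep (lcode table)) (conf 1 [::] [::] [::]) js = conf (qc q) w Z1 Z2].

Lemma traced_step q x w k q' m o : List.In (q', m) (gdelta q o) ->
  traced q' (F2xF2mul x m) w k -> traced q x (ocode o ++ w) k.+1.
Proof.
move=> Hin [js [Z1 [Z2 [Sj Aj /andP[R1 R2] [F1 F2] E]]]].
have Ht : tr q o (q', m) \in table by apply/tableP; constructor 3; exists q, o, (q', m).
exists (rcons js (index (tr q o (q', m)) table)),
  (foldr push Z1 (val m.1)), (foldr push Z2 (val m.2)); split.
- by rewrite size_rcons Sj.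
- by rewrite all_rcons index_mem Ht.
- by rewrite !reduced_foldr_push.
- by rewrite -!freered_mul.
by rewrite foldl_rcons E (ustep_conf _ _ _ _ (nth_index 0 Ht)) ?eqxx //; case: (o).
Qed.

Lemma acc_from_traced q x w k : acc_from q x w k -> traced q x w k.
Proof.
elim=> {q x w k} [q x aq ->|q x w k q' m Hin _ IH|q x a w k q' m Hin _ IH].
- have Ht : trans (qc q) 1 [::] [::] [::] \in table by apply/tableP; constructor 2; exists q.
  exists [:: index (trans (qc q) 1 [::] [::] [::]) table], [::], [::]; split=> //.
    by rewrite all_seq1 index_mem Ht.
  by apply: etrans (ustep_conf _ _ _ _ (nth_index 0 Ht) _) _.
- exact: traced_step Hin IH.
exact: traced_step Hin IH.
Qed.

Lemma ucheck_complete l b w k : acc_from (gq0 A) F2xF2e w k ->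
  k.+2 <= l -> size table <= b -> ucheck (lcode table) l b (wcode w).
Proof.
move=> /acc_from_traced [js [Z1 [Z2 [Sj Aj /andP[R1 R2] [F1 F2] E]]]] le leb.
(* Index 0 is the start transition, the head of [table]; it brings the number of entries to
   [k.+2]. *)
apply/hasP; exists (lcode (rcons js 0)).
  rewrite mem_iota ltnS lbound_lcode ?size_rcons ?Sj // all_rcons.
  rewrite (leq_trans _ leb) //; apply: sub_all Aj => j lt; exact: leq_trans lt leb.
move: F1 F2; rewrite /= !freered_id // => E1 E2.
rewrite /urun lfold_lcode foldl_rcons -/(conf 1 [::] [::] [::]) E.
by rewrite (@ustep_conf 0 _ _ _ _ 2 (qc (gq0 A)) [::] [::] [::]) // eqxx E1 E2.
Qed.

End Universal.

(** * The inclusion and its strictness *)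

Definition llen x := lfold (fun n _ => n.+1) 0 x.

Lemma llen_wcode (Sigma : finType) (w : seq Sigma) : llen (wcode w) = size w.
Proof.
rewrite /llen lfold_lcode -[RHS]add0n -(size_map (fun a => nat_of_ord (enum_rank a))).
by elim: (map _ w) 0 => [|a s IH] n /=; rewrite ?addn0 // IH addSnnS.
Qed.

Lemma PR_llen f : PR f -> PR (fun v => llen (f v)).
Proof.
by apply: PR_app1; apply: PR_lfold; [exact: PR_zero|exact: PR_var|apply: PR_succ; apply: PR_var].
Qed.

Lemma RE_ext (Sigma : finType) (L L' : seq Sigma -> Prop) :
  (forall w, L w <-> L' w) -> RE L -> RE L'.
Proof. by move=> E [M H]; exists M => w; rewrite -E. Qed.

Lemma is_O_n_affine t : is_O_n t -> exists c d, forall n, t n <= c * n + d.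
Proof.
move=> [c [n0 H]]; exists c, (\max_(i < n0) t i) => n.
have [/H le|lt] := leqP n0 n; first exact: leq_trans le (leq_addr _ _).
apply: leq_trans (leq_addl _ _); exact: (leq_bigmax (Ordinal lt)).
Qed.

Theorem theorem4p13 :
  (forall (Sigma : finType) (L : seq Sigma -> Prop),
      LGw_lin F2xF2mul F2xF2e L -> RE L) /\
  (exists (Sigma : finType) (L : seq Sigma -> Prop),
      RE L /\ ~ LGw_lin F2xF2mul F2xF2e L).
Proof.
split=> [Sigma L [A [t [HL [/is_O_n_affine [c [d Ht]] HA]]]]|].
  (* Accepted words have runs of at most c n + d steps; the two further entries are the start and
     end transitions. *)
  pose p x := ucheck (lcode (table A)) (c * llen x + d.+2) (size (table A)) x.
  apply: (@RE_ext _ (fun w => p (wcode w))) => [w|]; last first.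
    apply: RE_PR; apply: PR_ucheck; try exact: PR_const; last exact: PR_var.
    apply: PR_add; last exact: PR_const.
    by apply: PR_mul; [exact: PR_const|apply: PR_llen; apply: PR_var].
  rewrite HL; split=> [/ucheck_sound //|/HA [k [le Hk]]].
  apply: (ucheck_complete Hk) => //.
  by rewrite llen_wcode !addnS !ltnS; apply: leq_trans le (Ht _).
pose p x := let n := llen x in ~~ ucheck (hd n) (n * n + 2) n x.
exists unit, (fun w => p (wcode w)); split.
  have Hn : PR (fun v => llen (v 0)) by apply: PR_llen; apply: PR_var.
  apply: RE_PR; apply: PR_not; apply: PR_ucheck => //; [exact: PR_hd| |exact: PR_var].
  by apply: PR_add; [apply: PR_mul|exact: PR_const].
move=> [A [t [HL [[c [n0 Ht]] HA]]]].
(* the word length codes the table of [A] and is large compared with the other data *)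
have [n hn ltn] : exists2 n, hd n = lcode (table A) & c + n0 + size (table A) < n.
  by exists (ncons (lcode (table A)) (c + n0 + size (table A)));
    [apply: hd_ncons|apply: ltn_nconsr].
pose w := nseq n tt.
have E : p (wcode w) = ~~ ucheck (lcode (table A)) (n * n + 2) n (wcode w).
  by rewrite /p llen_wcode size_nseq hn.
have nL : ~ p (wcode w).
  move=> Hp; have [k [le Hk]] := HA w (proj1 (HL w) Hp).
  (* Since [n0 <= n] and [c < n], the run has at most [c * n <= n * n] steps; the summand 2 pays for
     the start and end transitions. *)
  have le2 : k.+2 <= n * n + 2.
    rewrite addn2 !ltnS; apply: leq_trans le _; rewrite size_nseq.
    by apply: leq_trans (Ht _ _) _; [lia|rewrite leq_mul2r; lia].
  have leb : size (table A) <= n by lia.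
  by move: Hp; rewrite E (ucheck_complete Hk le2 leb).
(* As [p] fails on [w], the checker has found a run of [A], which puts [w] into the language after
   all. *)
by have := nL; move/negP; rewrite E negbK => /ucheck_sound /HL /nL.
Qed.
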